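(* Every FUF filter $\mathcal{F}$ on $\omega$ is Hurewicz.
   Context: A filter on $\omega$ is a family $\mathcal{F}\subset\mathcal{P}(\omega)$ with $\emptyset\notin\mathcal{F}$, closed under intersections of two elements and under supersets in $\omega$; all filters are assumed to contain all cofinite subsets of $\omega$. $\mathcal{P}(\omega)$ carries the Cantor set topology obtained by identifying it with ${}^{\omega}2$ via characteristic functions, and $\mathcal{F}$ has the subspace topology. $[\omega]^{<\omega}$ is the set of finite subsets of $\omega$. A $\pi$-network with respect to $\mathcal{F}$ is a collection $\mathcal{X}\subset[\omega]^{<\omega}$ such that for every $F\in\mathcal{F}$ there is $x\in\mathcal{X}$ with $x\subset F$. A collection $\mathcal{S}\subset[\omega]^{<\omega}$ is said to $\mathcal{F}$-converge (to $\emptyset$) if for every $F\in\mathcal{F}$ the set $\{x\in\mathcal{S}:x\not\subset F\}$ is finite. The filter $\mathcal{F}$ is FUF (Fréchet–Urysohn for finite sets) if for every $\pi$-network $\mathcal{X}$ with respect to $\mathcal{F}$ consisting of nonempty finite subsets of $\omega$ there is an infinite $\mathcal{S}\subset\mathcal{X}$ that $\mathcal{F}$-converges. A space $X$ is Hurewicz if for every sequence $(\mathcal{U}_n)_{n<\omega}$ of open covers of $X$ there are finite $\mathcal{V}_n\subset\mathcal{U}_n$ such that every $x\in X$ belongs to $\bigcup\mathcal{V}_n$ for all but finitely many $n$. *)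

(* Defs.v *)
From HB Require Import structures.
From mathcomp Require Import all_boot all_order all_algebra.
From mathcomp Require Import all_classical all_reals all_analysis.

Set Implicit Arguments.
Unset Strict Implicit.
Unset Printing Implicit Defensive.

Local Open Scope classical_set_scope.

Definition charfun_omega (A : set nat) : cantor_space := fun n => `[< A n >].

(* P(omega) with the topology for which [charfun_omega], a bijection onto the
   Cantor space, is a homeomorphism. *)
Definition powerset_omega : Type := initial_topology charfun_omega.

HB.instance Definition _ := Topological.on powerset_omega.

(* For [F : set powerset_omega], the coercion [set_type] turns [F] into a type
   carrying the subspace topology. *)
Definition omega_filter (F : set powerset_omega) : Prop :=
  ProperFilter (F : set_system nat) /\
  forall A : set nat, finite_set (~` A) -> F A.

Definition pi_network (F : set powerset_omega) (X : set (set nat)) : Prop :=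
  X `<=` @finite_set nat /\
  forall A, F A -> exists2 x, X x & x `<=` A.

Definition converges_to_empty (F : set powerset_omega) (S : set (set nat)) :
    Prop :=
  S `<=` @finite_set nat /\
  forall A, F A -> finite_set [set x | S x /\ ~ (x `<=` A)].

Definition FUF (F : set powerset_omega) : Prop :=
  forall X : set (set nat),
    pi_network F X -> (forall x, X x -> x !=set0) ->
    exists S : set (set nat),
      [/\ S `<=` X, infinite_set S & converges_to_empty F S].

Definition open_cover (T : topologicalType) (U : set (set T)) : Prop :=
  U `<=` open /\ \bigcup_(A in U) A = setT.

Definition hurewicz (T : topologicalType) : Prop :=
  forall U : nat -> set (set T), (forall n, open_cover (U n)) ->
  exists V : nat -> set (set T),
    (forall n, finite_set (V n) /\ V n `<=` U n) /\
    forall x : T, \forall n \near \oo, (\bigcup_(A in V n) A) x.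

(* Main.v *)
Require Import Defs.
From mathcomp Require Import all_boot all_order all_algebra.
From mathcomp Require Import all_classical all_reals all_analysis.

(** Why the theorem holds.  A member [A] of the filter has a compact cone
    [{B | A `<=` B}], and this cone lies inside the filter.  Given an open cover
    [U], finitely many of its elements therefore cover the cone of [A], and by
    compactness already the trace on the filter of the cone of some finite
    [x `<=` A] ([finite_cone_subcover]).  So the finite sets whose cone is
    covered by finitely many elements of [U] form a pi-network.

    Given a sequence of covers [U n], let [X n] be the pi-network of the finite
    sets whose cone is finitely covered by each of [U 0], ..., [U n].  The
    Frechet-Urysohn property yields a diagonal sequence [s n] in [X n] that
    converges to the empty set ([FUF_diagonal]).  A finite subfamily of [U n]
    covering the cone of [s n] is then the required selection: a member [A] of
    the filter contains [s n], that is, lies in its cone, for almost all [n].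

    The diagonal sequence comes from the translation trick that shows
    Frechet-Urysohn topological groups to be strongly Frechet.  The property is
    applied to the single pi-network of all [n |: x] with [x] in [X n].  The
    added point [n] remembers the level of [x], and since complements of
    singletons belong to the filter, a convergent sequence meets each level
    finitely often, so that its levels tend to infinity. *)

Local Open Scope classical_set_scope.

Lemma finite_near_notin (K : set nat) :
  finite_set K -> \forall n \near \oo, ~ K n.
Proof.
move=> /finite_fsetP[X ->].
exists (\max_(i <- finmap.enum_fset X) i).+1 => // n /= ltXn nX.
by have := @leq_bigmax_seq _ _ xpredT id _ nX isT; rewrite leqNgt ltXn.
Qed.

Definition finitely_covered_cone (F : set powerset_omega)
    (U : set (set (set_type F))) (x : set nat) : Prop :=
  exists V, [/\ finite_set V, V `<=` U &
    forall B : set_type F, x `<=` set_val B -> (\bigcup_(W in V) W) B].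

(** The finite pieces [x] of [A] and the finite subfamilies [V] of [U] index a
    filter base, made of the members of [F] that contain [x] and escape [V].
    If none of these were empty, a cluster point [p] would contain [A], hence
    belong to [F] and to some open set of the cover, which contradicts the
    base element escaping that open set. *)
Lemma finite_cone_subcover (F : set powerset_omega) (U : set (set (set_type F)))
    (A : set nat) :
  (forall B C : set nat, B `<=` C -> F B -> F C) -> open_cover U -> F A ->
  exists x : set nat,
    [/\ finite_set x, x `<=` A & finitely_covered_cone F U x].
Proof.
move=> Fup [Uo Ucov] FA; apply: contrapT => noxV.
pose D := [set xV : set nat * set (set (set_type F)) |
  [/\ finite_set xV.1, xV.1 `<=` A, finite_set xV.2 & xV.2 `<=` U]].
pose E (xV : set nat * set (set (set_type F))) := [set p : cantor_space |
  exists B : set_type F, [/\ p = charfun_omega (set_val B),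
    xV.1 `<=` set_val B & ~ (\bigcup_(W in xV.2) W) B]].
have filterE : Filter (filter_from D E).
  apply: filter_from_filter.
    by exists (set0, set0); split => //=; exact: finite_set0.
  move=> [x V] [y W] [/= fx xA fV VU] [/= fy yA fW WU].
  exists (x `|` y, V `|` W).
    by split => /=; [rewrite finite_setU|rewrite subUset|
                     rewrite finite_setU|rewrite subUset].
  move=> p [B [/= pB]]; rewrite subUset bigcup_setU => -[xB yB] nVW.
  by split; exists B; split => // ?; apply: nVW; [left|right].
have properE : ProperFilter (filter_from D E).
  apply: filter_from_proper => -[x V] [/= fx xA fV VU].
  apply: contrapT => E0; apply: noxV; exists x; split => //.
  exists V; split => // B xB; apply: contrapT => nVB; apply: E0.
  by exists (charfun_omega (set_val B)), B.
have [p [_ clp]] := cantor_space_compact properE filterT.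
pose P : set nat := [set n | p n].
have Pp : charfun_omega P = p by apply/funext => n; rewrite /charfun_omega asboolb.
have AP : A `<=` P.
  move=> n An.
  have nbn : nbhs p [set q : cantor_space | q n = p n].
    exact: (@proj_continuous nat (fun=> bool) n p _ (discrete_set1 _)).
  have En : filter_from D E (E ([set n], set0)).
    by exists ([set n], set0) => //; split=> //= t ->.
  have [q [[B [qB nB _]] qn]] := clp _ _ En nbn.
  rewrite /P /= -qn qB; apply/asboolP; exact: nB.
have FP : P \in F by apply/mem_set; exact: Fup FA.
pose b : set_type F := exist _ P FP.
have [G UG Gb] : (\bigcup_(W in U) W) b by rewrite Ucov.
have [_ [W oW <-] WG] := Uo _ UG.
have nbW : nbhs p W.
  by apply: open_nbhs_nbhs; split=> //; rewrite -Pp; move: Gb; rewrite -WG.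
have EG : filter_from D E (E (set0, [set G])).
  by exists (set0, [set G]) => //; split=> //= t ->.
have [q [[B [qB _]]]] := clp _ _ EG nbW.
by rewrite /= bigcup_set1 -WG qB.
Qed.

(** The Frechet-Urysohn property selects one infinite convergent family from
    one pi-network; the diagonal form below selects one set from each of a
    decreasing sequence of pi-networks. *)
Lemma FUF_diagonal (F : set powerset_omega) (X : nat -> set (set nat)) :
  omega_filter F -> FUF F -> (forall n, pi_network F (X n)) ->
  (forall m n, m <= n -> X n `<=` X m) ->
  exists s : nat -> set nat, (forall n, X n (s n)) /\
    forall A, F A -> \forall n \near \oo, s n `<=` A.
Proof.
move=> [properF cofF] fuf netX decrX.
pose Y := [set y : set nat | exists n x, X n x /\ y = n |` x].
have netY : pi_network F Y.
  split=> [_ [n [x [Xx ->]]]|A FA].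
    by rewrite finite_setU; split; [exact: finite_set1|exact: (netX n).1].
  have [n An] := filter_ex FA.
  have [x Xx xA] := (netX n).2 _ FA.
  exists (n |` x); first by exists n, x.
  by rewrite subUset; split=> // t ->.
have Y0 y : Y y -> y !=set0 by move=> [n [x [_ ->]]]; exists n; left.
have [S [SY infS [_ convS]]] := fuf _ netY Y0.
have /infiniteP/pcard_leP/unsquash y := infS.
have Sy k : S (y k) by exact: funS.
have near_y (A : set nat) : F A -> \forall k \near \oo, y k `<=` A.
  move=> FA.
  suff /finite_near_notin : finite_set [set k | ~ y k `<=` A].
    by apply: filterS => k /contrapT.
  have -> : [set k | ~ y k `<=` A] = y @^-1` [set z | S z /\ ~ z `<=` A].
    by apply/seteqP; split=> k //= [].
  by apply: finite_preimage (convS _ FA) => k l _ _; apply: inj; rewrite in_setT.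
(* All but finitely many terms of [y] avoid the points below [N], so their
   marked points, hence their levels, are at least [N]. *)
have pick_s N : exists z, X N z /\ exists2 k, N <= k & z `<=` y k.
  have FN : F [set n | N <= n].
    apply: cofF; apply: sub_finite_set (finite_II N) => n /=.
    by move/negP; rewrite -ltnNge.
  have [k [yN leNk]] := filter_ex (filterI (near_y _ FN) (nbhs_infty_ge N)).
  have [n [x [Xx ykE]]] := SY _ (Sy k).
  exists x; split; last by exists k => //; rewrite ykE; exact: subsetUr.
  by apply: decrX Xx; apply: yN; rewrite ykE; left.
have [s sP] := choice pick_s.
exists s; split=> [n|A FA]; first by have [] := sP n.
have [N _ yA] := near_y _ FA.
exists N => // n /= leNn.
have [_ [k lenk sk]] := sP n.
by apply: subset_trans sk _; apply: yA; exact: leq_trans leNn lenk.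
Qed.

Theorem proposition4p1 (F : set powerset_omega) :
  omega_filter F -> FUF F -> hurewicz (set_type F).
Proof.
move=> omF fuf U covU; have [properF _] := omF.
have Fup (B C : set nat) : B `<=` C -> F B -> F C by exact: filterS.
pose X n := [set x | finite_set x /\
  forall i, i <= n -> finitely_covered_cone F (U i) x].
have netX n : pi_network F (X n).
  split=> [x []//|A FA].
  have /choice[x xP] i := finite_cone_subcover F (U i) A Fup (covU i) FA.
  exists (\bigcup_(i < n.+1) x i); last first.
    by apply: bigcup_sub => i _; have [] := xP i.
  split=> [|i lein].
    by apply: bigcup_finite => [|i _]; [exact: finite_II|have [] := xP i].
  have [_ _ [V [fV VU Vcov]]] := xP i.
  exists V; split=> // B xB; apply: Vcov.
  by apply: subset_trans xB => m xm; exists i.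
have decrX m n : m <= n -> X n `<=` X m.
  move=> lemn x [fx cx]; split=> // i leim.
  by apply: cx; exact: leq_trans lemn.
have [s [Xs convs]] := FUF_diagonal F X omF fuf netX decrX.
have /choice[V VP] n : finitely_covered_cone F (U n) (s n).
  by have [_] := Xs n; exact.
exists V; split=> [n|B]; first by have [] := VP n.
have FB : F (set_val B) by apply: set_mem; exact: valP.
apply: filterS (convs _ FB) => n snB.
by have [_ _] := VP n; exact.
Qed.
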